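(* Let $\alpha \in (0,\frac12)$. The dynamical system $(\mathcal D_\alpha, \mathcal B(\mathcal D_\alpha), \nu_\alpha, \mathcal T_\alpha)$ is a version of the natural extension of the dynamical system $(I_\alpha,\mathcal B_\alpha,\mu_\alpha,T_\alpha)$, where $\mu_\alpha := \nu_\alpha\circ\pi^{-1}$ and $\pi:\mathcal D_\alpha\to I_\alpha$ is the projection onto the first coordinate. That is: $\nu_\alpha$ is $\mathcal T_\alpha$-invariant, and $\nu_\alpha$-almost everywhere (ne1) $\mathcal T_\alpha$ is invertible, (ne2) $\pi$ is measurable and surjective, (ne3) $\pi\circ\mathcal T_\alpha = T_\alpha\circ\pi$, and (ne4) $\bigvee_{n=0}^\infty \mathcal T_\alpha^n\pi^{-1}(\mathcal B_\alpha) = \mathcal B(\mathcal D_\alpha)$.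
   Context: For $\alpha \in (0,1)$ let $D_\alpha = \bigcup_{n \ge 1} \big[ \frac{1}{n+\alpha}, \frac1n \big]$, $D_\alpha^{\mathsf c} = [0,1]\setminus D_\alpha$, $I_\alpha = [\min\{\alpha,1-\alpha\},1]$, $\mathcal B_\alpha$ the Borel $\sigma$-algebra on $I_\alpha$, and $T_\alpha : I_\alpha \to I_\alpha$, $T_\alpha(x) = \frac1x - \lfloor \frac1x \rfloor$ if $x \in D_\alpha^{\mathsf c}$, $T_\alpha(x) = 1 + \lfloor \frac1x \rfloor - \frac1x$ if $x \in D_\alpha$. Define $d_1(x) = \lfloor\frac1x\rfloor$, $\epsilon_1(x)=1$ if $x\in D_\alpha^{\mathsf c}$ and $d_1(x)=\lfloor\frac1x\rfloor+1$, $\epsilon_1(x)=-1$ otherwise. Let $\mathcal D_\alpha = [\alpha,\frac{\alpha}{1-\alpha}]\times[0,\infty) \cup (\frac{\alpha}{1-\alpha},1-\alpha]\times[0,1]\cup(1-\alpha,1]\times[-1,1]$, with Borel $\sigma$-algebra $\mathcal B(\mathcal D_\alpha)$, measure $\nu_\alpha(A) = \iint_A \frac{1}{(1+xy)^2}\,d\lambda^2(x,y)$ ($\lambda^2$ Lebesgue measure on $\mathbb R^2$), and map $\mathcal T_\alpha(x,y) = \big(T_\alpha(x), \frac{\epsilon_1(x)}{d_1(x)+y}\big)$. $\bigvee_{n\ge0}\mathcal T_\alpha^n\pi^{-1}(\mathcal B_\alpha)$ denotes the smallest $\sigma$-algebra containing all $\mathcal T_\alpha^n\pi^{-1}(\mathcal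 B_\alpha)$, $n\ge0$. *)

(* Defs.v *)
From HB Require Import structures.
From mathcomp Require Import all_boot all_order all_algebra.
From mathcomp Require Import all_classical all_reals all_analysis.

Set Implicit Arguments.
Unset Strict Implicit.
Unset Printing Implicit Defensive.
Import Order.TTheory GRing.Theory Num.Theory.
Local Open Scope classical_set_scope.
Local Open Scope ring_scope.

Section AlphaCF.
Variable R : realType.
Variable alpha : R.

Definition Dalpha : set R :=
  [set x | exists n : nat, (1 <= n)%N /\ (n%:R + alpha)^-1 <= x /\ x <= (n%:R)^-1].

Definition Dalpha_c : set R := `[0, 1] `\` Dalpha.

Definition Ialpha : set R := `[Num.min alpha (1 - alpha), 1].

Definition flr (x : R) : R := (Num.floor x)%:~R.

Definition Talpha (x : R) : R :=
  if `[< Dalpha x >] then 1 + flr x^-1 - x^-1 else x^-1 - flr x^-1.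

Definition d1 (x : R) : R := if `[< Dalpha x >] then flr x^-1 + 1 else flr x^-1.
Definition eps1 (x : R) : R := if `[< Dalpha x >] then -1 else 1.

Definition Dcal : set (R * R) :=
  [set z | (alpha <= z.1 <= alpha / (1 - alpha) /\ 0 <= z.2)
        \/ (alpha / (1 - alpha) < z.1 <= 1 - alpha /\ 0 <= z.2 <= 1)
        \/ (1 - alpha < z.1 <= 1 /\ -1 <= z.2 <= 1)].

Definition Tcal (z : R * R) : R * R :=
  (Talpha z.1, eps1 z.1 / (d1 z.1 + z.2)).

Definition nu (A : set (R * R)) : \bar R :=
  (\int[(@lebesgue_measure R) \x (@lebesgue_measure R)]_(z in A `&` Dcal)
     ((1 + z.1 * z.2) ^- 2)%:E)%E.

End AlphaCF.

(* Main.v *)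
Require Import Defs.
From HB Require Import structures.
From mathcomp Require Import all_boot all_order all_algebra.
From mathcomp Require Import all_classical all_reals all_analysis.
From mathcomp Require Import measurable_realfun ring lra.

Set Implicit Arguments.
Unset Strict Implicit.
Unset Printing Implicit Defensive.
Import Order.TTheory GRing.Theory Num.Theory.
Import numFieldNormedType.Exports.
Local Open Scope classical_set_scope.
Local Open Scope ring_scope.

(* On each strip of x the map Tcal is one of the bijections
     Phi s d (x, y) = (e (1/x - d), e / (d + y)),  e = (-1)^s,
   and the density (1 + x y)^-2 is preserved by every Phi s d.  Discarding the
   null set of points with a coordinate in the countable set
   {(a + b alpha) / (c + c' alpha)}, stable under inversion, negation and integer
   translations, all boundary cases disappear, and the images of the strips tile
   the domain: the preimages of a given point under the various Phi s d are
   (1/(w + k), p - k), k = 0, 1, ..., and exactly one of them lies in the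
   domain.  This gives bijectivity and, summing over the strips, invariance.
   For generation, G(x, y) = y/(1 + x y) satisfies
   G(Phi s d (x, y)) = e (x - x^2 G(x, y)), so along an orbit the fibre
   differences of G are multiplied by the squares of the first coordinates;
   the products of these tend to 0 fast enough, and y is recovered as a limit of
   functions of the past first coordinates. *)

(** * Measures given by a density *)

Section density_measure.
Local Open Scope ereal_scope.
Context (d : measure_display) (T : measurableType d) (R : realType).
Variables (mu : {measure set T -> \bar R}) (w : T -> R).
Hypotheses (mw : measurable_fun [set: T] w) (w0 : forall x, (0 <= w x)%R).

(** The proofs of measurability and nonnegativity are arguments, so that the measure structure can
    be inferred from the term itself. *)
Definition density_measure (_ : measurable_fun [set: T] w)
  (_ : forall x, (0 <= w x)%R) := fun A : set T => \int[mu]_(x in A) (w x)%:E.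
Local Notation m := (density_measure mw w0).

Let density0 : m set0 = 0.
Proof. exact: integral_set0. Qed.

Let density_ge0 A : 0 <= m A.
Proof. by apply: integral_ge0 => x _; rewrite lee_fin. Qed.

Let density_additive : semi_sigma_additive m.
Proof.
move=> F mF tF mUF.
apply: (@semi_sigma_additive_nng_induced _ _ _ mu (EFin \o w)) => //.
exact/measurable_EFinP.
Qed.

HB.instance Definition _ := isMeasure.Build _ _ _ m
  density0 density_ge0 density_additive.

Import HBNNSimple.

(** On indicators both sides agree by the definition of [m]; linearity gives simple functions, and
    monotone convergence along [nnsfun_approx] gives [g]. *)
Lemma ge0_integral_density (g : T -> \bar R) :
  measurable_fun [set: T] g -> (forall x, 0 <= g x) ->
  \int[m]_x g x = \int[mu]_x (g x * (w x)%:E).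
Proof.
move=> mg g0; pose g_ := nnsfun_approx measurableT mg.
have cg x : limn (fun n => (g_ n x)%:E) = g x.
  by apply/cvg_lim => //; exact: cvg_nnsfun_approx.
have mgn n : measurable_fun [set: T] (fun x => (g_ n x)%:E * (w x)%:E).
  by apply: emeasurable_funM; exact/measurable_EFinP.
transitivity (limn (fun n => \int[m]_x (g_ n x)%:E)).
  rewrite -monotone_convergence//.
  - by apply: eq_integral => x _; rewrite cg.
  - by move=> n; exact/measurable_EFinP/measurable_funP.
  - by move=> n y _; rewrite lee_fin.
  - by move=> y _ a b ab; rewrite lee_fin; exact/lefP/nd_nnsfun_approx.
transitivity (limn (fun n => \int[mu]_x ((g_ n x)%:E * (w x)%:E))); last first.
  rewrite -monotone_convergence//.
  - apply: eq_integral => x _; rewrite -cg; apply/cvg_lim => //.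
    by rewrite cg; apply: cvgeZr => //; exact: cvg_nnsfun_approx.
  - by move=> n x _; apply: mule_ge0; rewrite lee_fin.
  - move=> y _ a b ab; apply: lee_wpmul2r; rewrite lee_fin//.
    exact/lefP/nd_nnsfun_approx.
congr (limn _); apply/funext => n.
under [LHS]eq_integral do rewrite fimfunE -fsumEFin//.
rewrite ge0_integral_fsum//; last 2 first.
- by move=> r; exact/measurable_EFinP/measurableT_comp.
- by move=> r x _; exact: nnfun_muleindic_ge0.
transitivity (\sum_(k \in range (g_ n))
   \int[mu]_x (k%:E * ((\1_(g_ n @^-1` [set k]) x)%:E * (w x)%:E))).
  apply: eq_fsbigr => r; rewrite inE => -[z _ <-{r}].
  rewrite integralZl_indic_nnsfun// integral_indic//= setIT.
  rewrite ge0_integralZl//; last 3 first.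
  - by apply: emeasurable_funM => //; exact/measurable_EFinP.
  - by move=> x _; apply: mule_ge0; rewrite lee_fin.
  - by rewrite lee_fin.
  congr (_ * _); rewrite /density_measure integral_mkcond.
  apply: eq_integral => x _; rewrite patchE indicE.
  by case: ifP => xA; rewrite ?mul1e ?mul0e.
rewrite -ge0_integral_fsum//; last 2 first.
- move=> r; apply: emeasurable_funM => //.
  by apply: emeasurable_funM; exact/measurable_EFinP.
- move=> r x _; rewrite muleA; apply: mule_ge0; last by rewrite lee_fin.
  exact: nnfun_muleindic_ge0.
apply: eq_integral => x _; rewrite [in RHS]fimfunE -fsumEFin//.
rewrite ge0_mule_fsuml//.
  by apply: eq_fsbigr => r _; rewrite muleA.
by move=> r; exact: nnfun_muleindic_ge0.
Qed.

End density_measure.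

(** * Substitution on the line: reflection, translation, inversion *)

Section change_of_variables_1d.
Local Open Scope ereal_scope.
Context {R : realType}.
Local Notation mu := (@lebesgue_measure R).

(** The image under [phi] of the measure with density [w] agrees with Lebesgue measure on the
    intervals []a, b]], hence everywhere by uniqueness. *)
Lemma ge0_integral_lebesgue_comp (phi w : R -> R) (g : R -> \bar R) :
  measurable_fun [set: R] phi -> measurable_fun [set: R] w ->
  (forall x, 0 <= w x)%R ->
  (forall a b, (a < b)%R ->
    \int[mu]_(x in phi @^-1` `]a, b]) (w x)%:E = (b - a)%:E) ->
  measurable_fun [set: R] g -> (forall x, 0 <= g x) ->
  \int[mu]_x (g (phi x) * (w x)%:E) = \int[mu]_x g x.
Proof.
move=> mphi mw w0 H mg g0.
rewrite -(ge0_integral_density mu mw w0 (g := g \o phi)); last 2 first.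
- exact: (measurableT_comp mg mphi).
- by move=> x /=; exact: g0.
rewrite -(@ge0_integral_pushforward _ _ (measurableTypeR R)
  (measurableTypeR R) R phi mphi
  (density_measure mu mw w0) setT)//.
apply: eq_measure_integral => A mA _; apply/esym.
apply: lebesgue_measure_unique => // _ [[a b]] _ <-.
rewrite lebesgue_measure_itv/= lte_fin; case: ltP => ab.
  exact/esym/H.
apply/esym; rewrite /pushforward set_itv_ge ?preimage_set0 ?measure0//.
by rewrite -leNgt.
Qed.

Lemma ge0_integral_oppr (g : R -> \bar R) :
  measurable_fun [set: R] g -> (forall x, 0 <= g x) ->
  \int[mu]_x g (- x)%R = \int[mu]_x g x.
Proof.
move=> mg g0.
rewrite -[RHS](@ge0_integral_lebesgue_comp -%R (cst 1%R))//.
- by apply: eq_integral => x _; rewrite mule1.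

- move=> a b ab; rewrite [LHS](integral_cst mu _ 1%E)//; last first.
    by rewrite -[X in measurable X]setTI; exact: oppr_measurable.
  rewrite mul1e opp_preimage_itvbndbnd/= lebesgue_measure_itv/= lte_fin.
  by rewrite ltrN2 ab -EFinD; congr (_%:E); lra.
Qed.

Lemma ge0_integral_addr (c : R) (g : R -> \bar R) :
  measurable_fun [set: R] g -> (forall x, 0 <= g x) ->
  \int[mu]_x g (x + c)%R = \int[mu]_x g x.
Proof.
move=> mg g0.
have mc : measurable_fun [set: R] (fun x : R => x + c)%R.
  exact: measurable_funD.
rewrite -[RHS](@ge0_integral_lebesgue_comp (fun x => x + c)%R (cst 1%R))//.
- by apply: eq_integral => x _; rewrite mule1.
- move=> a b ab; rewrite [LHS](integral_cst mu _ 1%E)//; last first.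
    by rewrite -[X in measurable X]setTI; exact: mc.
  rewrite mul1e (_ : _ @^-1` _ = `](a - c)%R, (b - c)%R]%classic).
    rewrite [LHS](lebesgue_measure_itv `](a - c)%R, (b - c)%R])/= lte_fin ltrD2r ab -EFinD.
    by congr (_%:E); lra.
  by apply/seteqP; split=> x /=; rewrite !in_itv/= => /andP[? ?]; apply/andP;
    split; lra.
Qed.

(** Inverting only the positive half-line leaves the part of []a, b]] below 0 fixed, so that the
    only integrals to compute are those of [x ^- 2] over rays. *)
Let half_inv (x : R) : R := if (0 < x)%R then (x^-1)%R else x.
Let half_wgt (x : R) : R := if (0 < x)%R then (x ^- 2)%R else 1%R.

Lemma measurable_invr_setT : measurable_fun [set: R] (fun x : R => x^-1)%R.
Proof.
rewrite (_ : [set: R] = [set x : R | x != 0%R] `|` [set 0%R]); last first.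
  apply/seteqP; split=> // x _ /=.
  by case: (eqVneq x 0%R) => ?; [right|left].
have on0 : open [set x : R | x != 0%R].
  rewrite (_ : [set x : R | x != 0%R] = ~` [set 0%R]).
    by rewrite openC; exact: closed_eq.
  by apply/seteqP; split=> x /= /eqP.
apply/measurable_funU => //; first exact: open_measurable.
split.
- apply: open_continuous_measurable_fun => // x; rewrite inE/= => x0.
  exact: inv_continuous.
- exact: measurable_fun_set1.
Qed.

Let mif (f g : R -> R) : measurable_fun [set: R] f -> measurable_fun [set: R] g ->
  measurable_fun [set: R] (fun x => if (0 < x)%R then f x else g x).
Proof.
move=> mf mg; apply: measurable_fun_ifT => //.
exact: measurable_fun_ltr.
Qed.

Let mhalf_inv : measurable_fun [set: R] half_inv.
Proof. by apply: mif => //; exact: measurable_invr_setT. Qed.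

Let mhalf_wgt : measurable_fun [set: R] half_wgt.
Proof.
apply: mif => //; under eq_fun do rewrite -exprVn.
by apply: measurable_funX; exact: measurable_invr_setT.
Qed.

Let half_wgt_ge0 x : (0 <= half_wgt x)%R.
Proof. by rewrite /half_wgt; case: ifP => // x0; rewrite invr_ge0 sqr_ge0. Qed.

(** The fundamental theorem of calculus on a ray, with the primitive [- x^-1], which vanishes at
    infinity. *)
Lemma integral_inv_sqr (b : R) : (0 < b)%R ->
  \int[mu]_(x in `[b^-1%R, +oo[) ((x ^- 2)%R)%:E = b%:E.
Proof.
move=> b0; have bV0 : (0 < b^-1)%R by rewrite invr_gt0.
have d1 (x : R) : (0 < x)%R -> is_derive x 1%R (fun x : R => - x^-1)%R (x ^- 2)%R.
  move=> x0; apply: is_derive_eq; first by apply: is_deriveN; apply: is_deriveV; lra.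
  rewrite /GRing.scale/=; lra.
rewrite (@ge0_continuous_FTC2y _ _ (fun x => - x^-1)%R _ 0%R).
- by rewrite invrK -EFinB; congr (_%:E); lra.
- by move=> x _; rewrite invr_ge0 sqr_ge0.
- apply/continuous_in_subspaceT => x; rewrite inE/= in_itv/= andbT => bx.
  have x0 : (x != 0)%R by lra.
  apply: (@continuousV _ _ (fun y : R => y ^+ 2)%R); first by rewrite expf_neq0.
  exact: exprn_continuous.
- rewrite -oppr0; apply: cvgN; apply/gtr0_cvgV0.
    by exists 0%R.
  exact: cvg_id.
- by move=> x bx; have := d1 x (lt_trans bV0 bx) => -[].
- apply: cvgN; apply: cvg_at_right_filter; apply: inv_continuous; lra.
- move=> x; rewrite in_itv/= andbT => bx; rewrite derive1E.
  by have := d1 x (lt_trans bV0 bx) => -[].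
Qed.

Let half_inv_pos (b : R) : (0 < b)%R ->
  \int[mu]_(x in half_inv @^-1` `]0%R, b]) (half_wgt x)%:E = b%:E.
Proof.
move=> b0; rewrite (_ : _ @^-1` _ = `[b^-1%R, +oo[%classic); last first.
  apply/seteqP; split=> x /=; rewrite !in_itv/= /half_inv ?andbT.
    by case: ifPn => [x0 /andP[_]|/negP x0 /andP[]//]; rewrite invf_ple.
  move=> bx; have x0 : (0 < x)%R by rewrite (lt_le_trans _ bx)// invr_gt0.
  by rewrite x0 invr_gt0 x0/= invf_ple.
rewrite -[RHS]integral_inv_sqr//; apply: eq_integral => x.
rewrite inE/= in_itv/= andbT => bx; rewrite /half_wgt (lt_le_trans _ bx)//.
by rewrite invr_gt0.
Qed.

Let half_inv_neg (a b : R) : (a < b <= 0)%R ->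
  \int[mu]_(x in half_inv @^-1` `]a, b]) (half_wgt x)%:E = (b - a)%:E.
Proof.
move=> /andP[ab b0]; rewrite (_ : _ @^-1` _ = `]a, b]%classic); last first.
  apply/seteqP; split=> x /=; rewrite !in_itv/= /half_inv; case: ifPn => //.
    by move=> x0 /andP[_]; rewrite leNgt (le_lt_trans b0)// invr_gt0.
  by move=> x0 /andP[_ xb]; move: x0; rewrite ltNge (le_trans xb).
rewrite (eq_integral (cst 1)) ?integral_cst//; last first.
  move=> x; rewrite inE/= in_itv/= => /andP[_ xb].
  by rewrite /half_wgt ltNge (le_trans xb).
by rewrite mul1e [LHS](lebesgue_measure_itv `]a, b])/= lte_fin ab.
Qed.

Let half_inv_split (a b c : R) : (a <= b)%R -> (b <= c)%R ->
  \int[mu]_(x in half_inv @^-1` `]a, c]) (half_wgt x)%:E =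
  \int[mu]_(x in half_inv @^-1` `]a, b]) (half_wgt x)%:E +
  \int[mu]_(x in half_inv @^-1` `]b, c]) (half_wgt x)%:E.
Proof.
move=> ab bc.
have mI (I : interval R) : measurable (half_inv @^-1` [set` I]).
  by rewrite -[X in measurable X]setTI; apply: mhalf_inv.
rewrite -ge0_integral_setU//=; last 5 first.
- exact: mI.
- exact: mI.
- by apply/measurable_EFinP; exact: measurable_funTS.
- by move=> x _; rewrite lee_fin.
- rewrite disj_set2E -preimage_setI.
  apply/eqP/seteqP; split=> // x /=; rewrite !in_itv/= => -[]; lra.
congr integral; rewrite -preimage_setU; congr (_ @^-1` _).
apply/seteqP; split=> x /=; rewrite !in_itv/=.
  by move=> /andP[ax xc]; case: (leP x b) => xb; [left|right]; lra.
by move=> [|]; lra.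
Qed.

Let half_inv_itv (a b : R) : (a < b)%R ->
  \int[mu]_(x in half_inv @^-1` `]a, b]) (half_wgt x)%:E = (b - a)%:E.
Proof.
move=> ab; have [b0|b0] := leP b 0%R; first by rewrite half_inv_neg ?ab.
have [a0|a0] := ltP a 0%R.
  rewrite (half_inv_split (ltW a0) (ltW b0)) half_inv_pos// half_inv_neg ?a0 ?lexx//.
  by rewrite -EFinD; congr (_%:E); lra.
move: a0; rewrite le_eqVlt => /predU1P[<-|a0].
  by rewrite half_inv_pos// subr0.
(* For [0 < a], split []0, b]] at [a] and cancel the finite integral over []0, a]]. *)
have := half_inv_split (ltW a0) (ltW ab); rewrite !half_inv_pos//.
by move=> E; rewrite EFinB E addeAC subee// add0e.
Qed.

(* Inverting the positive half-line, reflecting, and inverting again inverts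
   both half-lines at once. *)
Lemma ge0_integral_invr (g : R -> \bar R) :
  measurable_fun [set: R] g -> (forall x, 0 <= g x) ->
  \int[mu]_x (g x^-1%R * (x ^- 2)%R%:E) = \int[mu]_x g x.
Proof.
move=> mg g0.
have half (h : R -> \bar R) : measurable_fun [set: R] h ->
    (forall x, 0 <= h x) ->
    \int[mu]_x (h (half_inv x) * (half_wgt x)%:E) = \int[mu]_x h x.
  by move=> mh h0; exact: ge0_integral_lebesgue_comp.
pose h x := g (half_inv x) * (half_wgt x)%:E.
have mh : measurable_fun [set: R] h.
  by apply: emeasurable_funM; [exact: (measurableT_comp mg)|exact/measurable_EFinP].
have h0 x : 0 <= h x by rewrite mule_ge0// lee_fin.
have mhN : measurable_fun [set: R] (fun x => h (- x)%R).
  by apply: (measurableT_comp mh); exact: oppr_measurable.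
pose k x := h (- half_inv x)%R * (half_wgt x)%:E.
have mk : measurable_fun [set: R] k.
  apply: emeasurable_funM; last exact/measurable_EFinP.
  exact: (measurableT_comp mhN).
have k0 x : 0 <= k x by rewrite mule_ge0// lee_fin.
rewrite -[RHS]half// -[RHS](ge0_integral_oppr mh h0).
rewrite -[RHS](half (fun x => h (- x)%R))// -[RHS](ge0_integral_oppr mk k0).
apply: ae_eq_integral => //.
- apply: emeasurable_funM.
    by apply: (measurableT_comp mg); exact: measurable_invr_setT.
  apply/measurable_EFinP; under eq_fun do rewrite -exprVn.
  by apply: measurable_funX; exact: measurable_invr_setT.
- by apply: (measurableT_comp mk); exact: oppr_measurable.
(* At 0 the integrands may differ: [0 ^- 2] is 0 by convention, whereas [half_wgt] is 1 there. *)
exists [set 0%R]; split => //; first exact: lebesgue_measure_set1.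
move=> x /= H; apply: contrapT => /eqP x0; apply: H => _.
rewrite /k /h /half_inv /half_wgt !oppr_gt0.
case: (ltgtP x 0%R) x0 => //= x0 _.
  rewrite !invrN opprK oppr_lt0 invr_gt0 ltNge (ltW x0)/= mule1.
  by rewrite sqrrN opprK.
by rewrite opprK oppr_lt0 x0 mule1.
Qed.

End change_of_variables_1d.

(** * Substitution in the plane and the invariant density *)

Section change_of_variables_2d.
Local Open Scope ereal_scope.
Context {R : realType}.
Local Notation mu := (@lebesgue_measure R).

(** [w] stands for the absolute value of the derivative of [phi]; taking the substitution rule
    itself as the property spares any discussion of singular points. *)
Definition subst1d (phi w : R -> R) :=
  [/\ measurable_fun [set: R] phi, measurable_fun [set: R] w,
      (forall x, 0 <= w x)%R &
      forall g : R -> \bar R, measurable_fun [set: R] g -> (forall x, 0 <= g x) ->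
        \int[mu]_x (g (phi x) * (w x)%:E) = \int[mu]_x g x].

(** Tonelli reduces the claim to the substitution in the second variable on each fibre and the one
    in the first variable for the fibre integrals. *)
Lemma subst1d_prod (phi1 w1 phi2 w2 : R -> R) (F : R * R -> \bar R) :
  subst1d phi1 w1 -> subst1d phi2 w2 ->
  measurable_fun [set: R * R] F -> (forall z, 0 <= F z) ->
  \int[mu \x mu]_z (F (phi1 z.1, phi2 z.2) * (w1 z.1 * w2 z.2)%:E) =
  \int[mu \x mu]_z F z.
Proof.
move=> [m1 mw1 w10 H1] [m2 mw2 w20 H2] mF F0.
have mFxy : measurable_fun [set: R * R] (fun z => F (phi1 z.1, phi2 z.2)).
  apply: (measurableT_comp mF); apply/measurable_fun_pairP; split => /=.
    exact: (measurableT_comp m1).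
  exact: (measurableT_comp m2).
have mFx x : measurable_fun [set: R] (fun y => F (x, y)).
  exact: (measurableT_comp mF).
pose H x := \int[mu]_y F (x, y).
have mH : measurable_fun [set: R] H.
  exact: (@measurable_fun_fubini_tonelli_F _ _ _ _ _ mu F mF F0).
have H0 x : 0 <= H x by apply: integral_ge0.
rewrite (@fubini_tonelli1 _ _ _ _ _ mu mu F)//.
rewrite (@fubini_tonelli1 _ _ _ _ _ mu mu); last 2 first.
- apply: emeasurable_funM => //; apply/measurable_EFinP.
  apply: measurable_funM; first exact: (measurableT_comp mw1).
  exact: (measurableT_comp mw2).
- by move=> z; apply: mule_ge0 => //; rewrite lee_fin mulr_ge0.
rewrite -[RHS](H1 H)//; apply: eq_integral => x _.
have -> : H (phi1 x) = \int[mu]_y (F (phi1 x, phi2 y) * (w2 y)%:E).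
  exact/esym/(H2 (fun y => F (phi1 x, y))).
rewrite /fubini_F/= muleC -ge0_integralZl//.
- by apply: eq_integral => y _; rewrite EFinM muleCA.
- apply: emeasurable_funM; last exact/measurable_EFinP.
  exact: (measurableT_comp (mFx _)).
- by move=> y _; apply: mule_ge0 => //; rewrite lee_fin.
- by rewrite lee_fin.
Qed.

Lemma subst1d_sign (s : bool) (phi w : R -> R) :
  subst1d phi w -> subst1d (fun x => (-1) ^+ s * phi x)%R w.
Proof.
case: s => -[mphi mw w0 H]; last first.
  by under eq_fun do rewrite mul1r; split.
under eq_fun do rewrite expr1 mulN1r; split => //.
  by apply: (measurableT_comp _ mphi); exact: oppr_measurable.
move=> g mg g0; rewrite -[RHS]ge0_integral_oppr// -[RHS]H//.
by apply: (measurableT_comp mg); exact: oppr_measurable.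
Qed.

Lemma measurable_inv_sqr : measurable_fun [set: R] (fun x : R => x ^- 2)%R.
Proof.
under eq_fun do rewrite -exprVn.
by apply: measurable_funX; exact: measurable_invr_setT.
Qed.

Lemma subst1d_inv_add (d : R) : subst1d (fun x => x^-1 - d)%R (fun x => x ^- 2)%R.
Proof.
split.
- by apply: measurable_funB => //; exact: measurable_invr_setT.
- exact: measurable_inv_sqr.
- by move=> x; rewrite invr_ge0 sqr_ge0.
move=> g mg g0; rewrite -[RHS](ge0_integral_addr (- d))//.
rewrite -[RHS](ge0_integral_invr (g := fun x => g (x - d)%R))//.
by apply: (measurableT_comp mg); exact: measurable_funB.
Qed.

Lemma subst1d_add_inv (d : R) :
  subst1d (fun y => (d + y)^-1)%R (fun y => (d + y) ^- 2)%R.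
Proof.
have md : measurable_fun [set: R] (fun y : R => d + y)%R by exact: measurable_funD.
split.
- exact: (measurableT_comp measurable_invr_setT md).
- exact: (measurableT_comp measurable_inv_sqr md).
- by move=> x; rewrite invr_ge0 sqr_ge0.
move=> g mg g0; rewrite -[RHS]ge0_integral_invr//.
rewrite -[RHS](ge0_integral_addr d)//.
- by apply: eq_integral => y _; rewrite (addrC y).
- apply: emeasurable_funM.
    by apply: (measurableT_comp mg); exact: measurable_invr_setT.
  by apply/measurable_EFinP; exact: measurable_inv_sqr.
- by move=> x; rewrite mule_ge0// lee_fin invr_ge0 sqr_ge0.
Qed.

Definition Phi (s : bool) (d : R) (z : R * R) : R * R :=
  ((-1) ^+ s * (z.1^-1 - d), (-1) ^+ s * (d + z.2)^-1)%R.

Definition nudens (z : R * R) : R := ((1 + z.1 * z.2) ^- 2)%R.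

Lemma measurable_nudens : measurable_fun [set: R * R] nudens.
Proof.
apply: (measurableT_comp measurable_inv_sqr); apply: measurable_funD => //.
exact: measurable_funM.
Qed.

Lemma nudens_ge0 z : (0 <= nudens z)%R.
Proof. by rewrite invr_ge0 sqr_ge0. Qed.

(** The factor [x ^- 2 * (d + y) ^- 2] is the Jacobian of [Phi s d], and its image point [(x', y')]
    satisfies [1 + x' y' = (1 + x y) / (x (d + y))]. *)
Lemma nudens_Phi (s : bool) (d : R) z : (z.1 != 0 -> d + z.2 != 0 ->
  nudens (Phi s d z) * (z.1 ^- 2 * (d + z.2) ^- 2) = nudens z)%R.
Proof.
move=> x0 y0; rewrite /nudens /Phi/= mulrACA -expr2 sqrr_sign mul1r.
have -> : (1 + (z.1^-1 - d) / (d + z.2) = (1 + z.1 * z.2) / (z.1 * (d + z.2)))%R.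
  by field; rewrite x0 y0.
rewrite expr_div_n invf_div exprMn -[(z.1 ^- 2 * _)%R]invfM mulrAC.
by rewrite divff ?mul1r// mulf_neq0// expf_neq0.
Qed.

Lemma integral_nudens_Phi (s : bool) (d : R) (B : set (R * R)) : measurable B ->
  (forall z, B z -> z.2 != 0 /\ (-1) ^+ s * z.1 + d != 0)%R ->
  \int[mu \x mu]_(z in Phi s d @^-1` B) (nudens z)%:E =
  \int[mu \x mu]_(z in B) (nudens z)%:E.
Proof.
move=> mB B0; rewrite integral_mkcond [RHS]integral_mkcond.
rewrite -[RHS](subst1d_prod (subst1d_sign s (subst1d_inv_add d))
  (subst1d_sign s (subst1d_add_inv d))); last 2 first.
- apply/(measurable_restrictT _ _).1 => //.
  by apply/measurable_EFinP/measurable_funTS; exact: measurable_nudens.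
- by move=> z; apply: erestrict_ge0 => x _; rewrite lee_fin nudens_ge0.
apply: eq_integral => z _; rewrite !patchE -[((-1) ^+ s * _, _)%R]/(Phi s d z).
rewrite (_ : (z \in _ @^-1` _) = (Phi s d z \in B)); last first.
  by apply/idP/idP; rewrite !inE.
case: ifPn; last by rewrite mul0e.
(* Since [0^-1 = 0], a point with [z.1 = 0] or [d + z.2 = 0] would be sent to a point that violates
   the hypothesis on [B]. *)
rewrite inE => /B0[/= y0 x0]; rewrite -EFinM nudens_Phi//.
  apply: contra x0 => /eqP ->; rewrite invr0 sub0r mulrA -expr2.
  by rewrite sqrr_sign mul1r addNr.
by apply: contra y0 => /eqP ->; rewrite invr0 mulr0.
Qed.

End change_of_variables_2d.

(** * The countable set of exceptional coordinates *)

Section exceptional_set.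
Context {R : realType}.
Variable alpha : R.

(** A vanishing denominator yields 0, which is a member anyway, so stability under inversion needs
    no proviso. *)
Definition Kset : set R :=
  [set (p.1.1%:~R + p.1.2%:~R * alpha) / (p.2.1%:~R + p.2.2%:~R * alpha) |
    p in [set: (int * int) * (int * int)]].

Lemma countable_Kset : countable Kset.
Proof. by apply: (sub_countable (card_image_le _ _)); exact: countableP. Qed.

Lemma KsetI (a b c e : int) :
  Kset ((a%:~R + b%:~R * alpha) / (c%:~R + e%:~R * alpha)).
Proof. by exists ((a, b), (c, e)). Qed.

Lemma Kset_lin (a b : int) : Kset (a%:~R + b%:~R * alpha).
Proof. by have := KsetI a b 1 0; rewrite mul0r addr0 divr1. Qed.

Lemma Kset_int (a : int) : Kset a%:~R.
Proof. by have := Kset_lin a 0; rewrite mul0r addr0. Qed.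

Lemma Kset_inv x : Kset x^-1 <-> Kset x.
Proof.
suff H y : Kset y -> Kset y^-1 by split=> /H//; rewrite invrK.
by move=> [[[a b] [c e]] _ <-]; rewrite /= invf_div; exact: KsetI.
Qed.

Lemma Kset_opp x : Kset (- x) <-> Kset x.
Proof.
suff H y : Kset y -> Kset (- y) by split=> /H//; rewrite opprK.
move=> [[[a b] [c e]] _ <-]/=; rewrite -mulNr opprD -mulNr -!rmorphN.
exact: KsetI.
Qed.

Lemma Kset_sign (s : bool) x : Kset ((-1) ^+ s * x) <-> Kset x.
Proof. by case: s; rewrite ?mul1r// expr1 mulN1r Kset_opp. Qed.

Lemma Kset_addz x (n : int) : Kset (x + n%:~R) <-> Kset x.
Proof.
suff H y (m : int) : Kset y -> Kset (y + m%:~R).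
  by split; [move=> /H-/(_ (- n)); rewrite rmorphN addrK|exact: H].
move=> [[[a b] [c e]] _ <-]/=.
have [->|h0] := eqVneq (c%:~R + e%:~R * alpha) 0.
  by rewrite invr0 mulr0 add0r; exact: Kset_int.
rewrite -[X in _ + X](mulfK h0) -mulrDl.
have -> : a%:~R + b%:~R * alpha + m%:~R * (c%:~R + e%:~R * alpha) =
  (a + m * c)%:~R + (b + m * e)%:~R * alpha.
  by rewrite !rmorphD !rmorphM/=; ring.
exact: KsetI.
Qed.

Lemma Kset_addn x (n : nat) : Kset (x + n%:R) <-> Kset x.
Proof. exact: (Kset_addz x n). Qed.

Lemma Kset_subn x (n : nat) : Kset (x - n%:R) <-> Kset x.
Proof. by have := Kset_addz x (- n%:Z); rewrite rmorphN. Qed.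

Lemma Kset_nat (n : nat) : Kset n%:R.
Proof. exact: (Kset_int n). Qed.

Lemma notKset_neq x y : ~ Kset x -> Kset y -> x != y.
Proof. by move=> Kx Ky; apply/eqP => xy; apply: Kx; rewrite xy. Qed.

End exceptional_set.

(** * The domain without its boundary *)

Section generic_domain.
Context {R : realType}.
Variable alpha : R.
Local Notation K := (Kset alpha).

Definition D0set : set (R * R) :=
  [set z | [/\ Dcal alpha z, ~ K z.1 & ~ K z.2]].

(** This is [Dcal] up to boundary points: instead of three rectangles cut according to [x], the
    constraints on [x] are read off from whether [y < 0] or [1 < y]. *)
Definition DX (x y : R) : Prop :=
  [/\ alpha < x < 1, -1 < y, (y < 0 -> 1 - alpha < x) &
      (1 < y -> x * (1 - alpha) < alpha)].

(** The conditions of [DX] in the variable [t = 1/x], in which the first coordinate of every branch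
    is affine. *)
Definition DT (t y : R) : Prop :=
  [/\ 1 < t, alpha * t < 1, -1 < y, (y < 0 -> t - alpha * t < 1) &
      (1 < y -> 1 - alpha < alpha * t)].

Lemma DX_DT x y : 0 < x -> DX x y <-> DT x^-1 y.
Proof.
move=> x0; have h1 : (1 < x^-1) = (x < 1) by rewrite invf_gt1.
have h2 : (alpha * x^-1 < 1) = (alpha < x) by rewrite ltr_pdivrMr// mul1r.
have h3 : (x^-1 - alpha * x^-1 < 1) = (1 - alpha < x).
  by rewrite -{1}[x^-1]mul1r -mulrBl ltr_pdivrMr// mul1r.
have h4 : (1 - alpha < alpha * x^-1) = (x * (1 - alpha) < alpha).
  by rewrite ltr_pdivlMr// mulrC.
rewrite /DT h1 h2 h3 h4; split; first by move=> [/andP[? ?] ? ? ?].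
by move=> [? ? ? ? ?]; split => //; apply/andP.
Qed.

(** Every edge of the three rectangles has a coordinate among 0, 1, -1, [alpha], [1 - alpha],
    [alpha / (1 - alpha)], all in [K]; off [K], strict and weak inequalities agree. *)
Lemma D0P z : 0 < alpha -> alpha < 2^-1 ->
  D0set z <-> [/\ DX z.1 z.2, ~ K z.1 & ~ K z.2].
Proof.
move=> a0 a2; have a1 : 0 < 1 - alpha by lra.
have Ka : K alpha by have := Kset_lin alpha 0 1; rewrite add0r mul1r.
have Kb : K (1 - alpha).
  by have := Kset_lin alpha 1 (-1); rewrite mulN1r.
have Kc : K (alpha / (1 - alpha)).
  by have := KsetI alpha 0 1 1 (-1); rewrite mulN1r add0r mul1r.
have K0 : K 0 by exact: (Kset_int _ 0).
have K1 : K 1 by exact: (Kset_int _ 1).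
have KN1 : K (-1) by exact: (Kset_int _ (-1)).
have E x : (x < alpha / (1 - alpha)) = (x * (1 - alpha) < alpha).
  by rewrite ltr_pdivlMr.
have c1 : alpha / (1 - alpha) < 1 by rewrite ltr_pdivrMr//; lra.
have c2 : alpha < alpha / (1 - alpha).
  by rewrite ltr_pdivlMr//; nra.
split=> [[D Kx Ky]|[[/andP[ax x1] y1 yn yp] Kx Ky]]; split => //.
- have := notKset_neq Kx Ka; have := notKset_neq Kx Kb.
  have := notKset_neq Kx Kc; have := notKset_neq Kx K1.
  have := notKset_neq Ky K0; have := notKset_neq Ky K1.
  have := notKset_neq Ky KN1; rewrite /DX -E.
  move: D => [[/andP[? ?] ?]|[[/andP[? ?] /andP[? ?]]|[/andP[? ?] /andP[? ?]]]];
    by move=> ? ? ? ? ? ? ?; split => *; lra.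
- rewrite /Dcal/=; rewrite -E in yp.
  have [y0|y0] := ltP z.2 0.
    by have := yn y0; right; right; split; lra.
  have [y2|y2] := ltP 1 z.2.
    by have := yp y2; left; split; lra.
  have [x2|x2] := leP z.1 (alpha / (1 - alpha)); first by left; split; lra.
  by have [x3|x3] := leP z.1 (1 - alpha); right; [left|right]; split; lra.
Qed.

End generic_domain.

(** * Branches of the map and their inverses *)

Section branches.
Context {R : realType}.
Variable alpha : R.
Local Notation K := (Kset alpha).
Local Notation D0 := (D0set alpha).

(** Open intervals suffice because their endpoints lie in [K]. For [s = true] the floor of [1/x] is
    [d - 1], whence the shift and the bound [2 <= d]. *)
Definition strip (s : bool) (d : nat) (x : R) : Prop :=
  if s then (2 <= d)%N /\ d%:R - 1 < x^-1 < d%:R - 1 + alpha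
  else (1 <= d)%N /\ d%:R + alpha < x^-1 < d%:R + 1.

Lemma DalphaP x : 0 < x -> 0 < alpha ->
  Dalpha alpha x <-> exists n : nat, (1 <= n)%N /\ n%:R <= x^-1 <= n%:R + alpha.
Proof.
move=> x0 a0; have H (n : nat) : (1 <= n)%N ->
    ((n%:R + alpha)^-1 <= x) = (x^-1 <= n%:R + alpha) /\
    (x <= n%:R^-1) = (n%:R <= x^-1).
  move=> n1; have n0 : (0 : R) < n%:R by rewrite ltr0n.
  by rewrite invf_ple ?posrE// ?ltr_wpDl// invf_pge ?posrE.
split=> -[n [n1]].
  by move=> [h1 h2]; exists n; have [<- <-] := H n n1; rewrite h1 h2.
by move=> /andP[h1 h2]; exists n; have [-> ->] := H n n1; rewrite h1 h2.
Qed.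

Lemma flrE (n : nat) (t : R) : n%:R <= t < n%:R + 1 -> flr t = n%:R.
Proof.
move=> h; rewrite /flr; have -> : Num.floor t = n%:Z by apply: floor_def; rewrite rmorphD/=.
by [].
Qed.

Lemma strip_branch s d x : 0 < alpha -> alpha < 2^-1 -> 0 < x -> strip s d x ->
  [/\ d1 alpha x = d%:R, eps1 alpha x = (-1) ^+ s &
      Talpha alpha x = (-1) ^+ s * (x^-1 - d%:R)].
Proof.
move=> a0 a2 x0; rewrite /strip; case: s => -[d1' /andP[h1 h2]].
  have dn : (d.-1)%:R = d%:R - 1 :> R by rewrite -subn1 natrB// (ltn_trans _ d1').
  have Dx : Dalpha alpha x.
    by apply/DalphaP => //; exists d.-1; rewrite dn; split; [case: (d) d1' => [|[]]|lra].
  rewrite /d1 /eps1 /Talpha asboolT// (@flrE d.-1) dn; last by lra.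
  by split; rewrite ?expr1//; lra.
have Dx : ~ Dalpha alpha x.
  move=> /DalphaP-/(_ x0 a0)[n [n1 /andP[h3 h4]]].
  have : n%:R < d%:R + 1 :> R by lra.
  rewrite natr1 ltr_nat ltnS => nd.
  have : d%:R < n%:R :> R by lra.
  by rewrite ltr_nat ltnNge nd.
rewrite /d1 /eps1 /Talpha asboolF// (@flrE d); last by lra.
by split; rewrite ?expr0 ?mul1r.
Qed.

Lemma strip_uniq s d s' d' x : 0 < alpha -> alpha < 2^-1 -> 0 < x ->
  strip s d x -> strip s' d' x -> s = s' /\ d = d'.
Proof.
move=> a0 a2 x0 /(strip_branch a0 a2 x0)[e1 e2 _].
move=> /(strip_branch a0 a2 x0)[e3 e4 _].
split; last by apply/eqP; rewrite -(eqr_nat R) -e1 e3.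
move: e2; rewrite e4; case: s {e1 e3 e4}; case: s' => //=; rewrite expr0 expr1; lra.
Qed.

Lemma strip_exists x : 0 < alpha -> alpha < 2^-1 -> 0 < x < 1 -> ~ K x ->
  exists s d, strip s d x.
Proof.
move=> a0 a2 /andP[x0 x1] Kx; set t := x^-1.
have t1 : 1 < t by rewrite invf_gt1.
have Kt : ~ K t by rewrite Kset_inv.
have := truncn_itv (ltW (lt_trans ltr01 t1)); set n := Num.truncn t.
rewrite -natr1 => /andP[n1 n2].
have nt : t != n%:R by apply: (notKset_neq Kt); exact: Kset_nat.
have nat' : t != n%:R + alpha.
  by apply: (notKset_neq Kt); have := Kset_lin alpha n 1; rewrite mul1r.
have n0 : (1 <= n)%N.
  by rewrite lt0n; apply/eqP => n0; move: n2; rewrite n0; lra.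
have [h|h] := ltP t (n%:R + alpha).
  exists true, n.+1; rewrite /strip -/t -natr1 addrK; split; first by rewrite ltnS.
  by lra.
by exists false, n; rewrite /strip -/t; split => //; lra.
Qed.

Lemma Tcal_Phi s d z : 0 < alpha -> alpha < 2^-1 -> 0 < z.1 -> strip s d z.1 ->
  Tcal alpha z = Phi s d%:R z.
Proof.
move=> a0 a2 x0 /(strip_branch a0 a2 x0)[e1 e2 e3].
by rewrite /Tcal /Phi e1 e2 e3.
Qed.

(** With [0^-1 = 0], inversion is an involution of the whole line, so this is the inverse of
    [Phi s d] without exceptional points. *)
Definition Psi (s : bool) (d : R) (z : R * R) : R * R :=
  (((-1) ^+ s * z.1 + d)^-1, (-1) ^+ s * z.2^-1 - d).

Lemma signK (s : bool) (x : R) : (-1) ^+ s * ((-1) ^+ s * x) = x.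
Proof. by rewrite mulrA -expr2 sqrr_sign mul1r. Qed.

Lemma PhiK s d : cancel (Phi s d) (Psi s d).
Proof.
move=> [x y]; rewrite /Phi /Psi/= signK subrK invrK; congr (_, _).
by rewrite invfM invrK invr_sign signK addrAC subrr add0r.
Qed.

Lemma PsiK s d : cancel (Psi s d) (Phi s d).
Proof.
move=> [u v]; rewrite /Phi /Psi/= invrK addrK signK; congr (_, _).
by rewrite addrC subrK invfM invrK invr_sign signK.
Qed.

Lemma measurable_Psi s d : measurable_fun [set: R * R] (Psi s d).
Proof.
apply/measurable_fun_pairP; split.
  have m1 : measurable_fun [set: R * R] (fun z => (-1) ^+ s * z.1 + d).
    by apply: measurable_funD => //; exact: measurable_funM.
  exact: (measurableT_comp measurable_invr_setT m1).
apply: measurable_funB => //; apply: measurable_funM => //.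
exact: (measurableT_comp measurable_invr_setT).
Qed.

Lemma D0_gt0 z : 0 < alpha -> alpha < 2^-1 -> D0 z -> 0 < z.1 < 1.
Proof. by move=> a0 a2 /D0P-/(_ a0 a2)[[/andP[? ?] _ _ _] _ _]; lra. Qed.

Lemma D0_DT z : 0 < alpha -> alpha < 2^-1 -> D0 z -> DT alpha z.1^-1 z.2.
Proof.
move=> a0 a2 Dz; have /andP[x0 _] := D0_gt0 a0 a2 Dz.
by apply/DX_DT => //; have [] := (D0P z a0 a2).1 Dz.
Qed.

(** For [s = true] the image lies over [(1 - alpha, 1)] with height in [(-1, 0)]. For [s = false]
    its height is positive and exceeds 1 only if [d = 1] and [y < 0]; then the constraint tied to
    [y < 0] becomes the one tied to heights above 1. *)
Lemma DX_Phi s d z : 0 < alpha -> alpha < 2^-1 -> DX alpha z.1 z.2 ->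
  strip s d z.1 -> DX alpha (Phi s d%:R z).1 (Phi s d%:R z).2.
Proof.
move=> a0 a2 Dz; have x0 : 0 < z.1 by have [/andP[? ?] _ _ _] := Dz; lra.
have := (DX_DT alpha z.2 x0).1 Dz; move: z {x0 Dz} => [x y]/=; rewrite /strip/=.
move=> [t1 t2 y1 yn yp] sd; move: sd t1 t2 yn yp; set t := x^-1; case: s => -[].
  move=> d2 /andP[h1 h2] t1 t2 yn yp; rewrite !expr1 !mulN1r -/t.
  have d2R : 2 <= d%:R :> R by rewrite (ler_nat _ 2).
  have v0 : 0 < (d%:R + y)^-1 by rewrite invr_gt0; lra.
  have v1 : (d%:R + y)^-1 < 1 by rewrite invf_lt1; lra.
  by split => *; lra.
move=> d1' /andP[h1 h2] t1 t2 yn yp; rewrite !expr0 !mul1r -/t.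
have d1R : 1 <= d%:R :> R by rewrite (ler_nat _ 1).
have v0 : 0 < (d%:R + y)^-1 by rewrite invr_gt0; lra.
split => [|||]; try lra.
rewrite invf_gt1; last by lra.
move=> dy1; have d2R : d%:R < 2 :> R by lra.
have d1 : d = 1%N.
  by move: d2R d1'; rewrite (ltr_nat _ _ 2) ltnS => *; apply/anti_leq/andP.
have : y < 0 by lra.
by move=> /yn; rewrite d1; nra.
Qed.

Lemma D0_Phi s d z : 0 < alpha -> alpha < 2^-1 -> D0 z -> strip s d z.1 ->
  D0 (Phi s d%:R z).
Proof.
move=> a0 a2 /(D0P _ a0 a2)[Dz Kx Ky] sd; apply/D0P => //; split.
- exact: DX_Phi.
- by rewrite Kset_sign Kset_subn Kset_inv.
- by rewrite Kset_sign Kset_inv addrC Kset_addn.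
Qed.

(** Raising [k] lowers the height [p - k]. The right [k] is the floor of [p], or 0 if [p < 0],
    unless the bound [alpha * (w + k) < 1] stops it earlier. *)
Lemma DT_shift (w p : R) : 0 < alpha -> alpha < 2^-1 -> 1 < w < 2 -> -1 < p ->
  (p < 0 -> w - alpha * w < 1) -> (forall j : nat, alpha * (w + j%:R) != 1) ->
  exists k : nat, DT alpha (w + k%:R) (p - k%:R).
Proof.
move=> a0 a2 /andP[w1 w2] p1 pn gen.
have aw : alpha * w < 1 by nra.
have [p0|p0] := ltP p 0.
  by exists 0%N; rewrite addr0 subr0; split => // ?; lra.
have := truncn_itv p0; set N := Num.truncn p; rewrite -natr1 => /andP[n1 n2].
have N0 : 0 <= N%:R :> R by [].
have [aN|aN] := ltP (alpha * (w + N%:R)) 1.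
  by exists N; split => // *; lra.
have exj : exists j : nat, 1 <= alpha * (w + j%:R) by exists N.
(* Take the predecessor [k] of the least index violating the bound: as [k + 1] violates it, strictly
   by [gen], [alpha * (w + k)] exceeds [1 - alpha], which permits heights above 1. *)
case: (ex_minnP exj) => -[|k]; first by rewrite addr0 leNgt aw.
move=> hk mink; have kN := mink N aN.
have {}kN : k%:R + 1 <= N%:R :> R by rewrite natr1 ler_nat.
have hk' := gen k.+1; exists k; move: hk hk'; rewrite -natr1 => hk hk'.
have ak : alpha * (w + k%:R) < 1.
  rewrite ltNge; by apply/negP => /mink; rewrite ltnn.
have k0 : 0 <= k%:R :> R by [].
by split => // *; nra.
Qed.

Lemma D0_Psi z : 0 < alpha -> alpha < 2^-1 -> D0 z ->
  exists s d, strip s d (Psi s d%:R z).1 /\ D0 (Psi s d%:R z).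
Proof.
move=> a0 a2 /(D0P _ a0 a2); case: z => [u v]/= [[/andP[au u1] v1 vn vp] Ku Kv].
have v0 : v != 0 by apply: (notKset_neq Kv); exact: (Kset_nat _ 0).
(* The sign of [v] dictates the sign of the branch, and [d0] is the least digit for that sign; the
   preimage with digit [d0] is [(1/w, p)]. *)
pose s := v < 0; pose e : R := (-1) ^+ s; pose d0 : nat := (if s then 2 else 1)%N.
pose w := e * u + d0%:R; pose p := e * v^-1 - d0%:R.
have w12 : 1 < w < 2.
  by rewrite /w /e /d0 /s; case: ifP => h; rewrite ?expr1 ?expr0; lra.
have p1 : -1 < p.
  rewrite /p /e /d0 /s; case: ifPn => h.
    have : 1 < (- v)^-1 by rewrite invf_gt1; lra.
    by rewrite invrN expr1 mulN1r; lra.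
  have : 0 < v^-1 by rewrite invr_gt0; lra.
  by rewrite expr0 mul1r; lra.
(* For [v < 0], [u > 1 - alpha] gives [w < 1 + alpha]. For [v > 0], [p < 0] means [v > 1], and the
   constraint on [u] at such heights applies. *)
have pn : p < 0 -> w - alpha * w < 1.
  rewrite /p /w /e /d0 /s; case: ifPn => h.
    by move=> _; have := vn h; rewrite expr1 mulN1r; nra.
  rewrite !expr0 !mul1r => h'; have : v^-1 < 1 by lra.
  by rewrite invf_lt1; [move=> /vp; lra|lra].
have Kw : ~ K w by rewrite Kset_addn Kset_sign.
have gen (j : nat) : alpha * (w + j%:R) != 1.
  have : w + j%:R != alpha^-1.
    apply: (@notKset_neq _ alpha); first by rewrite Kset_addn.
    by rewrite Kset_inv; have := Kset_lin alpha 0 1; rewrite add0r mul1r.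
  apply: contra => /eqP h; apply/eqP/(mulfI (lt0r_neq0 a0)).
  by rewrite h divff// lt0r_neq0.
have [k Dk] := DT_shift a0 a2 w12 p1 pn gen.
exists s, (d0 + k)%N; have eD : e * u + (d0 + k)%:R = w + k%:R.
  by rewrite natrD addrA.
have eP : e * v^-1 - (d0 + k)%:R = p - k%:R by rewrite natrD opprD addrA.
have Dw : 0 < (w + k%:R)^-1.
  by rewrite invr_gt0; have [/andP[? _] k0] := (w12, ler0n R k); lra.
rewrite /Psi/= -/e eD eP; split.
  rewrite /strip invrK -eD natrD /d0 /e /s; case: ifPn => h.
    by rewrite h expr1 mulN1r; have := vn h; split; [exact: leq_addr|lra].
  by rewrite (negbTE h) expr0 mul1r; split; [exact: leq_addr|lra].
apply/D0P => //=; split.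
- by apply/DX_DT => //; rewrite invrK.
- by rewrite Kset_inv Kset_addn.
- by rewrite !Kset_subn Kset_sign Kset_inv.
Qed.

(** If the digits differ by [m >= 1], then [t' = t + m] and [y' = y - m] for the reciprocals [t],
    [t']. When [y' < 0], [t' < 1 / (1 - alpha) < 2] contradicts [t' > 2]; otherwise [y > 1], as 1 is
    in [K], so [alpha t > 1 - alpha] and [alpha t' > 1]. *)
Lemma Phi_D0_inj s d d' z z' : 0 < alpha -> alpha < 2^-1 -> D0 z -> D0 z' ->
  strip s d z.1 -> strip s d' z'.1 ->
  Phi s d%:R z = Phi s d'%:R z' -> z = z'.
Proof.
move=> a0 a2; wlog dd : d d' z z' / (d <= d')%N => [H|].
  have [dd|/ltnW dd] := leqP d d'; first exact: H.
  by move=> Dz Dz' sd sd' /esym E; apply/esym; apply: (H d' d).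
move=> Dz Dz' sd sd' E.
have e1 : z = Psi s d%:R (Phi s d'%:R z') by rewrite -E PhiK.
move: dd; rewrite leq_eqVlt => /predU1P[dd|dd].
  by rewrite e1 dd PhiK.
exfalso.
have [t1 t2 y1 yn yp] := D0_DT a0 a2 Dz.
have [t1' t2' y1' yn' yp'] := D0_DT a0 a2 Dz'.
have E1 : z.1^-1 - d%:R = z'.1^-1 - d'%:R.
  by have := congr1 fst E; rewrite /Phi/= => /(congr1 ( *%R ((-1) ^+ s))); rewrite !signK.
have E2 : d%:R + z.2 = d'%:R + z'.2.
  have := congr1 snd E; rewrite /Phi/= => /(congr1 ( *%R ((-1) ^+ s))).
  by rewrite !signK => /invr_inj.
have dR : d%:R + 1 <= d'%:R :> R by rewrite natr1 ler_nat.
have [_ _ Ky] := Dz; have z1 : z.2 != 1 by apply: (notKset_neq Ky); exact: (Kset_nat _ 1).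
move: t1 t2 y1 yn yp t1' t2' y1' yn' yp' E1 E2 z1.
set t := z.1^-1; set t' := z'.1^-1; set y := z.2; set y' := z'.2.
move=> t1 t2 y1 yn yp t1' t2' y1' yn' yp' E1 E2 z1.
have [y0|y0] := ltP y' 0; first by have := yn' y0; nra.
by have := yp _; nra.
Qed.

End branches.

(** * Measurability and the subset of full measure *)

Section measurability.
Context {R : realType}.
Variable alpha : R.
Local Notation D0 := (D0set alpha).
Local Notation K := (Kset alpha).
Local Notation mu2 := ((@lebesgue_measure R) \x (@lebesgue_measure R))%E.

Lemma measurable_Kset : measurable K.
Proof.
apply: countable_measurable; first by move=> t; exact: measurable_set1.
exact: countable_Kset.
Qed.

Lemma measurable_Dcal : measurable (Dcal alpha).
Proof.
rewrite (_ : Dcal alpha = `[alpha, alpha / (1 - alpha)] `*` `[0, +oo[ `|`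
  (`]alpha / (1 - alpha), 1 - alpha] `*` `[0, 1] `|`
   `]1 - alpha, 1] `*` `[-1, 1])).
  apply: measurableU; first exact: measurableX.
  by apply: measurableU; exact: measurableX.
by apply/seteqP; split=> -[x y]; rewrite /Dcal/= !in_itv/= ?andbT.
Qed.

Definition Kcross : set (R * R) := K `*` setT `|` setT `*` K.

Lemma measurable_Kcross : measurable Kcross.
Proof.
by apply: measurableU; apply: measurableX => //; exact: measurable_Kset.
Qed.

Lemma D0setE : D0 = Dcal alpha `\` Kcross.
Proof.
apply/seteqP; split=> [z [Dz Kx Ky]|z [Dz /not_orP[Kx Ky]]].
  by split=> // -[[]|[]].
by split=> // Kz; [apply: Kx|apply: Ky].
Qed.

Lemma measurable_D0 : measurable D0.
Proof.
rewrite D0setE; apply: measurableD; first exact: measurable_Dcal.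
exact: measurable_Kcross.
Qed.

(** Each of the two families of lines has measure [0 * +oo], which is 0 by convention. *)
Lemma Kcross_null : (mu2 Kcross = 0)%E.
Proof.
have mK := measurable_Kset.
have K0 : (lebesgue_measure K = 0)%E.
  by apply: countable_lebesgue_measure0; exact: countable_Kset.
have N1 : (mu2 (K `*` setT) = 0)%E.
  transitivity (lebesgue_measure K * lebesgue_measure [set: R])%E.
    exact: product_measure1E.
  by rewrite K0 mul0e.
have N2 : (mu2 (setT `*` K) = 0)%E.
  transitivity (lebesgue_measure [set: R] * lebesgue_measure K)%E.
    exact: product_measure1E.
  by rewrite K0 mule0.
apply/eqP; rewrite -measure_le0.
apply: le_trans (measureU2 _ _ _) _; [exact: measurableX|exact: measurableX|].
by rewrite -[leRHS]adde0; apply: leeD; [rewrite -N1|rewrite -N2].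
Qed.

Lemma measurable_strip (s : bool) (d : nat) : measurable [set z : R * R | strip alpha s d z.1].
Proof.
suff H : measurable [set x : R | strip alpha s d x].
  by rewrite -[X in measurable X]setTI; exact: (@measurable_fst _ _ R R).
case: s.
  rewrite (_ : [set x | _] = if (2 <= d)%N then
    (fun x => x^-1) @^-1` `]d%:R - 1, d%:R - 1 + alpha[ else set0).
    case: ifP => // _; rewrite -[X in measurable X]setTI.
    exact: measurable_invr_setT.
  by apply/seteqP; split=> x /=; rewrite /strip; case: ifP => //= _ []//;
    rewrite in_itv.
rewrite (_ : [set x | _] = if (1 <= d)%N then
  (fun x => x^-1) @^-1` `]d%:R + alpha, d%:R + 1[ else set0).
  case: ifP => // _; rewrite -[X in measurable X]setTI.
  exact: measurable_invr_setT.
by apply/seteqP; split=> x /=; rewrite /strip; case: ifP => //= _ []//;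
  rewrite in_itv.
Qed.

Lemma measurable_flr : measurable_fun [set: R] (@flr R).
Proof.
apply: nondecreasing_measurable => // x y xy.
by rewrite /flr ler_int le_floor.
Qed.

Lemma measurable_Dalpha : measurable (Dalpha alpha).
Proof.
rewrite (_ : Dalpha alpha = \bigcup_(n in [set n | (1 <= n)%N])
    `[(n%:R + alpha)^-1, n%:R^-1]%classic).
  by apply: bigcup_measurable => n _; exact: measurable_itv.
apply/seteqP; split=> x; rewrite /Dalpha/=.
  by move=> [n [n1 [h1 h2]]]; exists n => //=; rewrite in_itv/= h1 h2.
by move=> [n n1]/=; rewrite in_itv/= => /andP[h1 h2]; exists n.
Qed.

Lemma measurable_Tcal : measurable_fun [set: R * R] (Tcal alpha).
Proof.
have mD : measurable_fun [set: R] (fun x => `[< Dalpha alpha x >]).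
  apply: (measurable_fun_bool true); rewrite setTI.
  rewrite (_ : _ @^-1` _ = Dalpha alpha); first exact: measurable_Dalpha.
  by apply/seteqP; split=> x /asboolP.
have mf : measurable_fun [set: R] (fun x : R => flr x^-1).
  exact: (measurableT_comp measurable_flr measurable_invr_setT).
have mi := @measurable_invr_setT R.
have mT : measurable_fun [set: R] (Talpha alpha).
  apply: measurable_fun_ifT => //; last exact: measurable_funB.
  by apply: measurable_funB => //; exact: measurable_funD.
have md : measurable_fun [set: R] (d1 alpha).
  by apply: measurable_fun_ifT => //; exact: measurable_funD.
have me : measurable_fun [set: R] (eps1 alpha).
  exact: measurable_fun_ifT.
apply/measurable_fun_pairP; split; first exact: (measurableT_comp mT).
apply: measurable_funM; first exact: (measurableT_comp me).
apply: (measurableT_comp mi); apply: measurable_funD => //.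
exact: (measurableT_comp md).
Qed.

Lemma fst_Dcal : 0 < alpha -> alpha < 2^-1 -> fst @` Dcal alpha = Ialpha alpha.
Proof.
move=> a0 a2; have a1 : 0 < 1 - alpha by lra.
have c1 : alpha / (1 - alpha) < 1 by rewrite ltr_pdivrMr//; lra.
have c2 : alpha < alpha / (1 - alpha) by rewrite ltr_pdivlMr//; nra.
rewrite /Ialpha (_ : Num.min _ _ = alpha); last by apply/min_idPl; lra.
apply/seteqP; split=> [_ [[x y] D <-]|x]/=; rewrite in_itv/=.
  move: D; rewrite /Dcal/=.
  by move=> [[/andP[? ?] ?]|[[/andP[? ?] /andP[? ?]]|[/andP[? ?] /andP[? ?]]]]; lra.
move=> /andP[h1 h2]; exists (x, 0) => //; rewrite /Dcal/=.
have [x2|x2] := leP x (alpha / (1 - alpha)); first by left; split; lra.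
by have [x3|x3] := leP x (1 - alpha); right; [left|right]; split; lra.
Qed.

Lemma nu_D0 (X : set (R * R)) : measurable X ->
  nu alpha X = (\int[mu2]_(z in X `&` D0) (nudens z)%:E)%E.
Proof.
move=> mX; have mXD := measurableI _ _ mX measurable_Dcal.
rewrite /nu (@ge0_negligible_integral _ _ R mu2 (X `&` Dcal alpha) Kcross); last 5 first.
- exact: measurable_Kcross.
- exact: mXD.
- by apply/measurable_EFinP/measurable_funTS; exact: measurable_nudens.
- by move=> z _; rewrite lee_fin; exact: nudens_ge0.
- exact: Kcross_null.
by rewrite D0setE setIDA.
Qed.

Lemma nu_Dcal_setD_D0 : (nu alpha (Dcal alpha `\` D0) = 0)%E.
Proof.
rewrite nu_D0; last exact: measurableD measurable_Dcal measurable_D0.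
rewrite (_ : _ `&` _ = set0) ?integral_set0//.
by apply/seteqP; split=> z // -[[_ h] /h].
Qed.

End measurability.

(** * Bijectivity and invariance *)

Section invariance.
Context {R : realType}.
Variables (alpha : R) (ha0 : 0 < alpha) (ha1 : alpha < 2^-1).
Local Notation D0 := (D0set alpha).
Local Notation T := (Tcal alpha).
Local Notation mu2 := ((@lebesgue_measure R) \x (@lebesgue_measure R))%E.

Lemma strip_shift_gt0 s d z : D0 z -> strip alpha s d z.1 -> 0 < d%:R + z.2.
Proof.
move=> /(D0_DT ha0 ha1)[_ _ y1 _ _]; rewrite /strip => H.
have d1 : 1 <= d%:R :> R.
  by rewrite (ler_nat _ 1); case: s H => -[dn _]; rewrite // ltnW.
lra.
Qed.

Lemma Tcal_D0_inj z z' : D0 z -> D0 z' -> T z = T z' -> z = z'.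
Proof.
move=> Dz Dz'; have /andP[x0 x1] := D0_gt0 ha0 ha1 Dz.
have /andP[x0' x1'] := D0_gt0 ha0 ha1 Dz'.
have [_ Kz _] := Dz; have [_ Kz' _] := Dz'.
have [|s [d sd]] := strip_exists ha0 ha1 _ Kz; first by rewrite x0.
have [|s' [d' sd']] := strip_exists ha0 ha1 _ Kz'; first by rewrite x0'.
rewrite (Tcal_Phi ha0 ha1 x0 sd) (Tcal_Phi ha0 ha1 x0' sd') => E.
(* As [d + y] is positive on [D0], the second coordinate of the image has the sign of the branch. *)
have ss : s = s'.
  have := congr1 snd E; rewrite /Phi/=.
  have := strip_shift_gt0 Dz sd; have := strip_shift_gt0 Dz' sd'.
  rewrite -(invr_gt0 (_ + z.2)) -(invr_gt0 (_ + z'.2)).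
  by case: (s); case: (s'); rewrite ?expr0 ?expr1// => *; lra.
by rewrite -ss in sd' E; exact: (Phi_D0_inj ha0 ha1 Dz Dz' sd sd').
Qed.

Lemma Tcal_D0 z : D0 z -> D0 (T z).
Proof.
move=> Dz; have /andP[x0 x1] := D0_gt0 ha0 ha1 Dz; have [_ Kz _] := Dz.
have [|s [d sd]] := strip_exists ha0 ha1 _ Kz; first by rewrite x0.
by rewrite (Tcal_Phi ha0 ha1 x0 sd); exact: D0_Phi.
Qed.

Lemma Tcal_Psi s d z : D0 (Psi s d%:R z) -> strip alpha s d (Psi s d%:R z).1 ->
  T (Psi s d%:R z) = z.
Proof.
move=> Dz sd; have /andP[x0 _] := D0_gt0 ha0 ha1 Dz.
by rewrite (Tcal_Phi ha0 ha1 x0 sd) PsiK.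
Qed.

Lemma Tcal_bij : set_bij D0 D0 T.
Proof.
split.
- exact: Tcal_D0.
- by move=> z z' /[!inE]; exact: Tcal_D0_inj.
- move=> z Dz; have [s [d [sd DP]]] := D0_Psi ha0 ha1 Dz.
  by exists (Psi s d%:R z) => //; exact: Tcal_Psi.
Qed.

(** One natural number codes the branch, the sign by its parity and the digit by its half, so that
    countable unions run over [nat]. *)
Definition stripD0 (n : nat) : set (R * R) :=
  D0 `&` [set z | strip alpha (odd n) n./2 z.1].

Lemma measurable_stripD0 n : measurable (stripD0 n).
Proof.
by apply: measurableI; [exact: measurable_D0|exact: measurable_strip].
Qed.

Lemma stripD0_cover z : D0 z -> exists n, stripD0 n z.
Proof.
move=> Dz; have /andP[x0 x1] := D0_gt0 ha0 ha1 Dz; have [_ Kz _] := Dz.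
have [|s [d sd]] := strip_exists ha0 ha1 _ Kz; first by rewrite x0.
exists (s + d.*2)%N; split => //=.
by rewrite oddD odd_double addbF oddb half_bit_double.
Qed.

Lemma stripD0_uniq n m z : stripD0 n z -> stripD0 m z -> n = m.
Proof.
move=> [Dz sn] [_ sm]; have /andP[x0 _] := D0_gt0 ha0 ha1 Dz.
have [e1 e2] := strip_uniq ha0 ha1 x0 sn sm.
by rewrite -(odd_double_half n) -(odd_double_half m) e1 e2.
Qed.

Local Notation Phin n := (Phi (odd n) (n./2)%:R).
Local Notation Psin n := (Psi (odd n) (n./2)%:R).

Lemma nu_invariant (A : set (R * R)) : measurable A ->
  nu alpha (Dcal alpha `&` T @^-1` A) = nu alpha A.
Proof.
move=> mA.
have mTA : measurable (T @^-1` A).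
  by rewrite -[X in measurable X]setTI; exact: measurable_Tcal.
rewrite !nu_D0//; last by apply: measurableI => //; exact: measurable_Dcal.
rewrite setIAC (setIidr (_ : D0 `<=` Dcal alpha)); last by move=> z [].
(* This is the part of [A] in the image of the strip [n]; writing the image as a preimage under the
   inverse branch makes it measurable. *)
pose F n := A `&` D0 `&` Psin n @^-1` stripD0 n.
have mF n : measurable (F n).
  apply: measurableI; first exact: measurableI mA (measurable_D0 _).
  rewrite -[X in measurable X]setTI.
  by apply: measurable_Psi => //; exact: measurable_stripD0.
pose E n := T @^-1` A `&` stripD0 n.
have mE n : measurable (E n).
  by apply: measurableI => //; exact: measurable_stripD0.
have EF n : E n = Phin n @^-1` F n.
  apply/seteqP; split=> z.
    move=> [Az [Dz sz]]; have /andP[x0 _] := D0_gt0 ha0 ha1 Dz.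
    rewrite /F/= PhiK; split; last by [].
    split; last exact: D0_Phi.
    by rewrite -(Tcal_Phi ha0 ha1 x0 sz).
  rewrite /F/= PhiK => -[[Az DPz] [Dz sz]].
  have /andP[x0 _] := D0_gt0 ha0 ha1 Dz.
  by split=> //=; rewrite (Tcal_Phi ha0 ha1 x0 sz).
have -> : D0 `&` T @^-1` A = \bigcup_n E n.
  apply/seteqP; split=> z; last by move=> [n _ [? []]].
  by move=> [Dz Az]; have [n sn] := stripD0_cover Dz; exists n.
have -> : A `&` D0 = \bigcup_n F n.
  apply/seteqP; split=> z; last by move=> [n _ []].
  move=> [Az Dz]; have [y Dy Ty] := set_bij_surj Tcal_bij Dz.
  have [n [_ sn]] := stripD0_cover Dy; exists n => //; split => //=.
  have /andP[x0 _] := D0_gt0 ha0 ha1 Dy.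
  by rewrite -Ty (Tcal_Phi ha0 ha1 x0 sn) PhiK.
have mnd (X : set (R * R)) : measurable_fun X (EFin \o @nudens R).
  by apply/measurable_EFinP/measurable_funTS; exact: measurable_nudens.
have nn (X : set (R * R)) z : X z -> (0 <= (EFin \o @nudens R) z)%E.
  by move=> _; rewrite lee_fin; exact: nudens_ge0.
have tE : trivIset setT E.
  by move=> n m _ _ [z [[_ sn] [_ sm]]]; exact: stripD0_uniq sn sm.
(* Disjointness of the images amounts to injectivity: a common point would be the image of two
   points of [D0], one in each strip. *)
have tF : trivIset setT F.
  move=> n m _ _ [z [[_ Fn] [_ Fm]]]; apply: (stripD0_uniq Fn).
  have [Dn sn] := Fn; have [Dm sm] := Fm.
  rewrite (Tcal_D0_inj Dn Dm) //.
  by rewrite (Tcal_Psi Dn sn) (Tcal_Psi Dm sm).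
rewrite (@ge0_integral_bigcup _ _ R mu2 E (EFin \o @nudens R) mE (mnd _) (nn _) tE).
rewrite (@ge0_integral_bigcup _ _ R mu2 F (EFin \o @nudens R) mF (mnd _) (nn _) tF).
apply: eq_eseriesr => n _; rewrite EF integral_nudens_Phi// => z [[_ Dz] [DP sP]].
have [_ _ Ky] := Dz; split.
  by apply: (notKset_neq Ky); exact: (Kset_nat _ 0).
have /andP[x0 _] := D0_gt0 ha0 ha1 DP; apply: contraL x0 => /eqP x0.
by rewrite /Psi/= x0 invr0 ltxx.
Qed.

End invariance.

(** * Contraction along the fibres *)

Section contraction.
Context {R : realType}.
Variables (alpha : R) (ha0 : 0 < alpha) (ha1 : alpha < 2^-1).
Local Notation T := (Tcal alpha).
Local Notation K := (Kset alpha).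

Definition DY : set (R * R) := [set z | DX alpha z.1 z.2 /\ ~ K z.1].

(** On each fibre, the primitive in [y] of the density [nudens] that vanishes at 0. *)
Definition Gfun (z : R * R) : R := z.2 / (1 + z.1 * z.2).

Lemma DY_bounds z : DY z -> [/\ alpha < z.1, z.1 < 1, -1 < z.2 & 0 < 1 + z.1 * z.2].
Proof.
move=> [[/andP[h1 h2] h3 _ _] _]; split => //; move: ha0 => a0.
by have [y0|y0] := ltP z.2 0; nra.
Qed.

Lemma DY_branch z : DY z -> exists s d, [/\ strip alpha s d z.1,
  T z = Phi s d%:R z & DY (Phi s d%:R z)].
Proof.
move=> Dz; have [h1 h2 h3 h4] := DY_bounds Dz; have [DXz Kz] := Dz.
have x0 : 0 < z.1 by exact: lt_trans ha0 h1.
have [|s [d sd]] := strip_exists ha0 ha1 _ Kz; first by rewrite x0.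
exists s, d; split => //; first exact: Tcal_Phi.
by split; [exact: DX_Phi|rewrite /= Kset_sign Kset_subn Kset_inv].
Qed.

(** By the formula for [1 + x' y'] at the image, the left side is [(-1) ^+ s * x / (1 + x y)], and
    [1 / (1 + x y) = 1 - x * Gfun z]. *)
Lemma Gfun_Phi s d z : DY z -> strip alpha s d z.1 ->
  Gfun (Phi s d%:R z) = (-1) ^+ s * (z.1 - z.1 ^+ 2 * Gfun z).
Proof.
move=> Dz sd; have [h1 h2 h3 h4] := DY_bounds Dz.
have x0 : 0 < z.1 by exact: lt_trans ha0 h1.
have d1R : 1 <= d%:R :> R.
  by rewrite (ler_nat _ 1); case: (s) sd => -[dn _]; rewrite // ltnW.
rewrite /Gfun /Phi/= mulrACA -expr2 sqrr_sign mul1r -mulrA; congr (_ * _).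
have xn : z.1 != 0 by rewrite gt_eqF.
have yn : d%:R + z.2 != 0 by rewrite gt_eqF//; lra.
have hn : 1 + z.1 * z.2 != 0 by rewrite gt_eqF.
have -> : 1 + (z.1^-1 - d%:R) / (d%:R + z.2) =
    (1 + z.1 * z.2) / (z.1 * (d%:R + z.2)).
  by field; rewrite xn yn.
by field; rewrite hn xn yn.
Qed.

(* p is the product of the first coordinates along the orbit. The bound
   p <= M * (1 - z.1) forces p = O(1/n) and absorbs the size 1/(1 - z.1) that
   Gfun may have near the indifferent fixed point 1. *)
Lemma fibre_contraction (M : R) n z : 0 < M -> 1 <= M * alpha -> DY z ->
  1 <= M * (1 - (iter n T z).1) ->
  exists p, [/\ 0 < p <= 1, p <= M * (1 - z.1), p * (M + n%:R) <= M &
    forall z', DY z' -> z'.1 = z.1 ->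
      (iter n T z').1 = (iter n T z).1 /\
      `|Gfun (iter n T z) - Gfun (iter n T z')| = p ^+ 2 * `|Gfun z - Gfun z'|].
Proof.
move=> M0 Ma; elim: n z => [|n IH] z Dz.
  move=> /= Mz; exists 1; split => //; first by rewrite ltr01 lexx.
    by rewrite addr0 mul1r.
  by move=> z' _ ->; rewrite expr1n mul1r.
rewrite iterSr => Mz.
have [s [d [sd Tz DP]]] := DY_branch Dz.
have [h1 h2 h3 h4] := DY_bounds Dz.
have x0 : 0 < z.1 by exact: lt_trans ha0 h1.
have DTz : DY (T z) by rewrite Tz.
have [p [/andP[p0 p1] pM pn H]] := IH _ DTz Mz.
(* On the branch with the indifferent fixed point 1 the image [x'] satisfies [x (1 - x') = 1 - x],
   which carries the bound over exactly. On all others [1/x >= 1 + alpha], so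
   [x <= M * alpha * x <= M * (1 - x)]. *)
have q1 : z.1 * p <= M * (1 - z.1).
  have [[ss dd]|nd] := pselect (s = true /\ d = 2%N).
    move: pM; rewrite Tz /Phi ss dd/= expr1 mulN1r => pM.
    have e : z.1 * (M * (1 + (z.1^-1 - 2))) = M * (1 - z.1).
      by field; rewrite gt_eqF.
    by rewrite -e ler_pM2l//; lra.
  have t1 : 1 + alpha <= z.1^-1.
    move: ha0 ha1 => a0 a2; move: sd nd; rewrite /strip; case: (s) => -[dn /andP[e1 e2]] nd.
      have : (3 <= d)%N.
        by rewrite ltn_neqAle dn andbT; apply/eqP => d2; apply: nd.
      by rewrite -(ler_nat R); lra.
    by move: dn; rewrite -(ler_nat R); lra.
  have : (1 + alpha) * z.1 <= 1 by rewrite -ler_pdivlMr// div1r.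
  by nra.
exists (z.1 * p); split => //.
- by apply/andP; split; [exact: mulr_gt0|nra].
(* The sum of [x * p * (M + n) <= x * M] and [x * p <= M * (1 - x)]. *)
- by rewrite -natr1; nra.
move=> z' Dz' zz'; have sd' : strip alpha s d z'.1 by rewrite zz'.
have x0' : 0 < z'.1 by rewrite zz'.
have Tz' := Tcal_Phi ha0 ha1 x0' sd'.
have DTz' : DY (T z').
  by rewrite Tz'; split; [exact: DX_Phi Dz'.1 sd'|rewrite /Phi/= zz'; case: DP].
rewrite iterSr; have [|e1 e2] := H _ DTz'.
  by rewrite Tz Tz' /Phi/= zz'.
split => //; rewrite e2 Tz Tz' !Gfun_Phi// -mulrBr normrM normr_sign mul1r zz'.
have -> : z.1 - z.1 ^+ 2 * Gfun z - (z.1 - z.1 ^+ 2 * Gfun z') =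
  z.1 ^+ 2 * (Gfun z' - Gfun z) by ring.
rewrite normrM normrX.
rewrite (ger0_norm (ltW x0)) (distrC (Gfun z')) exprMn.
by rewrite mulrA (mulrC (p ^+ 2)).
Qed.

(** Comparing with the point of height 0 on the same fibre makes the approximating value a function
    of [z.1] alone. *)
Lemma Gfun_approx (M : R) n z : 0 < M -> 1 <= M * alpha -> DY z ->
  1 <= M * (1 - (iter n T z).1) ->
  (iter n T (z.1, 0)).1 = (iter n T z).1 /\
  `|Gfun (iter n T z) - Gfun (iter n T (z.1, 0))| <= 2 * M ^+ 2 / (M + n%:R).
Proof.
move=> M0 Ma Dz Mz; have [p [/andP[p0 p1] pM pn H]] := fibre_contraction M0 Ma Dz Mz.
have [h1 h2 h3 h4] := DY_bounds Dz.
have Dz0 : DY (z.1, 0).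
  split; last exact: Dz.2.
  by split => /= *; lra.
have [e1 ->] := H _ Dz0 erefl; split => //.
rewrite {2}/Gfun/= mul0r subr0.
have Mn : 0 < M + n%:R by rewrite ltr_wpDr.
rewrite ler_pdivlMr//.
(* One factor [p] absorbs the possible blow-up of [Gfun z]; the other supplies the decay in [n]. For
   [y < 0], [1 - x <= 1 + x y]; for [y >= 0], [M * x >= 1] suffices. *)
have G1 : p * `|Gfun z| <= 2 * M.
  move: ha0 => a0; rewrite /Gfun normrM normfV (ger0_norm (ltW h4)) mulrA.
  rewrite ler_pdivrMr//.
  have M1 : 0 <= M * (1 + z.1 * z.2) by rewrite mulr_ge0 ?ltW.
  have [y0|y0] := ltP z.2 0; [rewrite (ltr0_norm y0)|rewrite (ger0_norm y0)].
    have f1 : M * (1 - z.1) <= M * (1 + z.1 * z.2).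
      by rewrite ler_pM2l//; nra.
    have f2 : p * - z.2 <= p by rewrite ger_pMr//; lra.
    lra.
  have f1 : 1 <= M * z.1 by apply: (le_trans Ma); rewrite ler_pM2l// ltW.
  have f2 : p * z.2 <= z.2 by rewrite ler_piMl.
  have f3 : z.2 <= M * z.1 * z.2 by rewrite ler_peMl.
  lra.
have -> : p ^+ 2 * `|Gfun z| * (M + n%:R) = (p * `|Gfun z|) * (p * (M + n%:R)) by ring.
apply: (le_trans (ler_wpM2r _ G1)); first by rewrite mulr_ge0 ?ltW.
by nra.
Qed.

End contraction.

(** * Recovering the second coordinate from the past *)

Section generation.
Context {R : realType}.
Variables (alpha : R) (ha0 : 0 < alpha) (ha1 : alpha < 2^-1).
Local Notation D0 := (D0set alpha).
Local Notation T := (Tcal alpha).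

(** Measurable functions are handled for the sigma-algebra on the whole type; this passes back to
    the one relative to [D]. *)
Lemma trace_g_sigma_algebra (U : Type) (D : set U) (G : set (set U)) :
  (forall E, G E -> E `<=` D) ->
  <<s G >> `<=` [set X | <<s D, G >> (D `&` X)].
Proof.
move=> GD; apply: smallest_sub.
  split=> [|A DA|A DA] /=.
  - by rewrite setI0; exact: sigma_algebra0.
  - rewrite (_ : D `&` _ = D `\` (D `&` A)); first exact: sigma_algebraCD.
    by rewrite setDIr setDv set0U setTD setDE.
  - by rewrite setI_bigcupr; exact: sigma_algebra_bigcup.
by move=> E GE /=; rewrite (setIidr (GD _ GE)); exact: sub_sigma_algebra.
Qed.

Definition Sinv (z : R * R) : R * R := get [set y | D0 y /\ T y = z].

Lemma SinvP z : D0 z -> D0 (Sinv z) /\ T (Sinv z) = z.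
Proof.
move=> Dz; have [_ _ /(_ _ Dz)[y Dy Ty]] := Tcal_bij ha0 ha1.
by apply: (@getPex _ [set y | D0 y /\ T y = z]); exists y.
Qed.

Lemma iter_Tcal_D0 n z : D0 z -> D0 (iter n T z).
Proof. by move=> Dz; elim: n => //= n; exact: Tcal_D0. Qed.

Lemma iter_SinvP n z : D0 z -> D0 (iter n Sinv z) /\ iter n T (iter n Sinv z) = z.
Proof.
move=> Dz; elim: n => //= n [Dn En]; have [DS ES] := SinvP Dn.
by split => //; rewrite -iterS iterSr ES.
Qed.

Lemma iter_SinvK n z : D0 z -> iter n Sinv (iter n T z) = z.
Proof.
move=> Dz; elim: n => // n IH; rewrite iterSr iterS.
have [DS ES] := SinvP (iter_Tcal_D0 n.+1 Dz).
rewrite (_ : Sinv _ = iter n T z) //; apply: (Tcal_D0_inj ha0 ha1) => //.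
exact: iter_Tcal_D0.
Qed.

(** Forward images of vertical cylinders thus become conditions on the first coordinate [n] steps
    back, which is therefore measurable for the generated sigma-algebra. *)
Lemma iter_Tcal_image n (B : set R) :
  iter n T @` (D0 `&` fst @^-1` B) = D0 `&` [set z | B (iter n Sinv z).1].
Proof.
apply/seteqP; split=> [_ [z [Dz Bz] <-]|z [Dz Bz]].
  by split; [exact: iter_Tcal_D0|rewrite /= iter_SinvK].
by have [DS ES] := iter_SinvP n Dz; exists (iter n Sinv z).
Qed.

(** Strip by strip, the forward image is a preimage under a measurable inverse branch. *)
Lemma measurable_Tcal_image (X : set (R * R)) : measurable X -> X `<=` D0 ->
  measurable (T @` X).
Proof.
move=> mX XD.
rewrite (_ : T @` X = \bigcup_n Psi (odd n) (n./2)%:R @^-1` (X `&` stripD0 alpha n)).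
  apply: bigcup_measurable => n _; rewrite -[X in measurable X]setTI.
  apply: measurable_Psi => //; apply: measurableI => //.
  exact: measurable_stripD0.
apply/seteqP; split=> [_ [z Xz <-]|z [n _ [Xz [Dz sz]]]].
  have Dz := XD _ Xz; have [n sn] := stripD0_cover ha0 ha1 Dz; exists n => //=.
  have [_ sz] := sn; have /andP[x0 _] := D0_gt0 ha0 ha1 Dz.
  by rewrite (Tcal_Phi ha0 ha1 x0 sz) PhiK.
by exists (Psi (odd n) (n./2)%:R z) => //; exact: Tcal_Psi.
Qed.

Lemma measurable_iter_Tcal_image n (X : set (R * R)) : measurable X -> X `<=` D0 ->
  measurable (iter n T @` X).
Proof.
move=> mX XD; elim: n => [|n IH]; first by rewrite image_id.
rewrite (_ : iter n.+1 T @` X = T @` (iter n T @` X)).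
  by apply: measurable_Tcal_image => // _ [z Xz <-]; exact/iter_Tcal_D0/XD.
by rewrite -image_comp.
Qed.

Definition gens : set (set (R * R)) :=
  [set E | exists (n : nat) (B : set R),
    [/\ measurable B, B `<=` Ialpha alpha &
        E = iter n T @` (D0 `&` fst @^-1` B)]].

Lemma gens_sub E : gens E -> E `<=` D0.
Proof. by move=> [n [B [_ _ ->]]] _ [z [Dz _] <-]; exact: iter_Tcal_D0. Qed.

Local Notation U := (g_sigma_algebraType gens).

Lemma D0_Ialpha z : D0 z -> Ialpha alpha z.1.
Proof. by move=> [Dz _ _]; rewrite -fst_Dcal//; exists z. Qed.

Lemma measurable_gens_past n :
  measurable_fun (D0 : set U) (fun z : U => (iter n Sinv z).1 : R).
Proof.
move=> mD Y mY; apply: sub_sigma_algebra.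
have mI : measurable (Ialpha alpha) by exact: measurable_itv.
exists n, (Y `&` Ialpha alpha); split => //; first exact: measurableI.
rewrite iter_Tcal_image; apply/seteqP; split=> z [Dz Yz]; split => //.
  by split => //; apply: D0_Ialpha; have [] := iter_SinvP n Dz.
by case: Yz.
Qed.

Lemma measurable_gens_D0 : measurable (D0 : set U).
Proof.
apply: sub_sigma_algebra; exists 0%N, (Ialpha alpha); split => //.
  exact: measurable_itv.
rewrite iter_Tcal_image; apply/seteqP; split=> z; last by case.
by move=> Dz; split => //; exact: D0_Ialpha.
Qed.

Lemma measurable_iter_Tcal n : measurable_fun [set: R * R] (iter n T).
Proof.
elim: n => [|n IH]; first exact: measurable_id.
exact: (measurableT_comp (measurable_Tcal alpha) IH).
Qed.

Lemma measurable_Gfun : measurable_fun [set: R * R] (@Gfun R).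
Proof.
apply: measurable_funM => //.
have m1 : measurable_fun [set: R * R] (fun z => 1 + z.1 * z.2).
  by apply: measurable_funD => //; exact: measurable_funM.
exact: (measurableT_comp measurable_invr_setT m1).
Qed.

Lemma D0_DY z : D0 z -> DY alpha z.
Proof. by move=> /(D0P _ ha0 ha1)[]. Qed.

(** Go back [n] steps, reset the height to 0 and return: only the past first coordinate is used. *)
Let past_Gfun n (z : U) : R := Gfun (iter n T ((iter n Sinv z).1, 0)).

Lemma measurable_past_Gfun n : measurable_fun (D0 : set U) (past_Gfun n).
Proof.
have m1 : measurable_fun [set: R] (fun x : R => (x, 0 : R)).
  apply/measurable_fun_pairP; split; first exact: measurable_id.
  exact: measurable_cst.
have m2 := measurableT_comp (measurable_iter_Tcal n) m1.
have m3 := measurableT_comp measurable_Gfun m2.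
exact: (measurableT_comp m3 (measurable_gens_past n)).
Qed.

Lemma cvg_past_Gfun z : D0 z -> past_Gfun n z @[n --> \oo] --> Gfun z.
Proof.
move=> Dz; have [h1 h2 _ _] := DY_bounds ha0 (D0_DY Dz).
have x1 : 0 < 1 - z.1 by lra.
(* The two summands secure the two lower bounds required of [M]. Dependence on [z] is harmless,
   since pointwise convergence suffices. *)
pose M := alpha^-1 + (1 - z.1)^-1.
have aV : 0 < alpha^-1 by rewrite invr_gt0.
have xV : 0 < (1 - z.1)^-1 by rewrite invr_gt0.
have M0 : 0 < M by rewrite addr_gt0.
have Ma : 1 <= M * alpha.
  by rewrite mulrDl mulVf ?gt_eqF// lerDl mulr_ge0 ?ltW.
have Mx : 1 <= M * (1 - z.1).
  by rewrite mulrDl mulVf ?gt_eqF// lerDr mulr_ge0 ?ltW.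
have B n : `|Gfun z - past_Gfun n z| <= 2 * M ^+ 2 / (M + n%:R).
  have [DS ES] := iter_SinvP n Dz.
  have := @Gfun_approx _ _ ha0 ha1 M n (iter n Sinv z) M0 Ma (D0_DY DS).
  by rewrite ES => /(_ Mx)[].
apply/cvgrPdist_le => e e0.
near=> n; apply: (le_trans (B n)).
have Mn : 0 < M + n%:R by rewrite ltr_wpDr.
rewrite ler_pdivrMr// -ler_pdivrMl//.
have : e^-1 * (2 * M ^+ 2) <= n%:R by near: n; exact: nbhs_infty_ger.
by lra.
Unshelve. all: by end_near. Qed.

Lemma measurable_gens_fst : measurable_fun (D0 : set U) (fun z : U => z.1 : R).
Proof. exact: (measurable_gens_past 0). Qed.

(** As a pointwise limit [Gfun] is measurable, and [y = G / (1 - x G)] because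
    [1 - x G = 1 / (1 + x y)]. *)
Lemma measurable_gens_snd : measurable_fun (D0 : set U) (fun z : U => z.2 : R).
Proof.
have mG : measurable_fun (D0 : set U) (fun z : U => Gfun z).
  apply: (measurable_fun_cvg measurable_past_Gfun) => z Dz.
  exact: cvg_past_Gfun.
have m1 : measurable_fun (D0 : set U) (fun z : U => 1 - z.1 * Gfun z).
  apply: measurable_funB => //; apply: measurable_funM => //.
  exact: measurable_gens_fst.
have m2 : measurable_fun (D0 : set U) (fun z : U => (1 - z.1 * Gfun z)^-1).
  exact: (measurableT_comp measurable_invr_setT m1).
apply: (eq_measurable_fun (fun z : U => Gfun z * (1 - z.1 * Gfun z)^-1)).
  move=> z /set_mem Dz; have [h1 h2 h3 h4] := DY_bounds ha0 (D0_DY Dz).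
  have hn : 1 + z.1 * z.2 != 0 by rewrite gt_eqF.
  have -> : 1 - z.1 * Gfun z = (1 + z.1 * z.2)^-1 by rewrite /Gfun; field.
  by rewrite invrK /Gfun divfK.
exact: measurable_funM.
Qed.

Lemma gens_measurable (A : set (R * R)) :
  measurable A -> <<s D0, gens >> (D0 `&` A).
Proof.
move=> mA; suff H : measurable (D0 `&` A : set U).
  have := trace_g_sigma_algebra gens_sub H.
  by rewrite /= setIA setIid.
have : measurable_fun (D0 : set U) (id : U -> R * R).
  apply: (measurability _ (measurable_prod_measurableType _ _)).
  move=> _ [_ [X mX [Y mY <-]] <-].
  have := measurableI _ _ (measurable_gens_fst measurable_gens_D0 mX)
    (measurable_gens_snd measurable_gens_D0 mY).
  congr measurable; apply/seteqP; split=> z /=.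
    by move=> [[? ?] [? ?]].
  by move=> [? [? ?]].
by move=> /(_ measurable_gens_D0 _ mA).
Qed.

(** One inclusion is the recovery of both coordinates; the other is that forward images of
    measurable subsets of [D0] are measurable. *)
Lemma generated_trace :
  <<s D0, gens >> = [set D0 `&` A | A in [set A : set (R * R) | measurable A]].
Proof.
have mD := measurable_D0 alpha.
apply/seteqP; split; last by move=> _ [A mA <-]; exact: gens_measurable.
have E : [set D0 `&` A | A in [set A : set (R * R) | measurable A]] =
    [set X | measurable X /\ X `<=` D0].
  apply/seteqP; split=> [_ [A mA <-]|X [mX XD]].
    by split; [exact: measurableI|exact: subIsetl].
  by exists X => //; exact: setIidr.
rewrite E; apply: smallest_sub.
  split=> [|A [mA AD]|A mA] /=.
  - by split => //; exact: measurable0.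
  - by split; [exact: measurableD|exact: subDsetl].
  - split; first by apply: bigcup_measurable => n _; have [] := mA n.
    by apply: bigcup_sub => n _; have [] := mA n.
move=> X GX; split; last exact: gens_sub.
move: GX => [n [B [mB _ ->]]]; apply: measurable_iter_Tcal_image.
  apply: measurableI => //; rewrite -[X in measurable X]setTI.
  exact: (@measurable_fst _ _ R R).
by move=> z [].
Qed.

End generation.

Unset Implicit Arguments.

Theorem theorem4p1 (R : realType) (alpha : R) (ha0 : 0 < alpha) (ha1 : alpha < 2^-1) :
  (* (D_alpha, B(D_alpha), nu_alpha, T_alpha) is a dynamical system:
     T_alpha is measurable and maps D_alpha into itself nu-a.e. *)
  measurable_fun (Dcal alpha) (Tcal alpha) /\
  (* nu_alpha is T_alpha-invariant *)
  (forall A : set (R * R), measurable A -> A `<=` Dcal alpha ->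
     nu alpha (Dcal alpha `&` Tcal alpha @^-1` A) = nu alpha A) /\
  (* (ne2) pi is measurable and surjective onto I_alpha *)
  measurable_fun (Dcal alpha) fst /\ fst @` Dcal alpha = Ialpha alpha /\
  (* (ne3) pi o T_alpha = T_alpha o pi *)
  (forall z, Dcal alpha z -> fst (Tcal alpha z) = Talpha alpha (fst z)) /\
  (* nu-almost everywhere: a full-measure subset D0 on which *)
  exists D0 : set (R * R),
    [/\ measurable D0, D0 `<=` Dcal alpha, nu alpha (Dcal alpha `\` D0) = 0%E,
        (* (ne1) T_alpha is invertible on D0 *)
        set_bij D0 D0 (Tcal alpha) &
        (* (ne4) \bigvee_n T^n pi^{-1}(B_alpha) = B(D_alpha), on D0 *)
        <<s D0, [set E | exists (n : nat) (B : set R),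
                   [/\ measurable B, B `<=` Ialpha alpha &
                       E = iter n (Tcal alpha) @` (D0 `&` fst @^-1` B)]] >>
        = [set D0 `&` A | A in [set A : set (R * R) | measurable A]]].
Proof.
split; first exact: measurable_funS (measurable_Tcal alpha).
split; first by move=> A mA _; exact: nu_invariant.
split; first exact: measurable_funTS measurable_fst.
split; first exact: fst_Dcal.
split; first by [].
exists (D0set alpha); split.
- exact: measurable_D0.
- by move=> z [].
- exact: nu_Dcal_setD_D0.
- exact: Tcal_bij.
- exact: generated_trace.
Qed.
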